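(* Let $(A,\wedge,1)$ be a bounded semilattice with bottom $0$, endowed with the hemiimplicative semilattice structure $(A,\wedge,\to,1)$ in which $\to$ is one of the following two operations: (i) $a\to b=1$ if $a=b$, and $a\to b=0$ if $a\neq b$; or (ii) $a\to b=1$ if $a\le b$, and $a\to b=0$ if $a\not\leq b$. Let $F$ be a filter of $(A,\wedge,\to,1)$. Then $F$ is congruent if and only if $F=\{1\}$ or $F=A$.
   Context: A bounded semilattice $(A,\wedge,1)$ is a meet-semilattice with greatest element $1$, ordered by $a\le b$ iff $a\wedge b=a$. A hemiimplicative semilattice is an algebra $(A,\wedge,\to,1)$ such that $(A,\wedge,1)$ is a bounded semilattice, $a\to a=1$ for all $a$, and $a\le b\to c$ implies $a\wedge b\le c$. In it, $a\leftrightarrow b:=(a\to b)\wedge(b\to a)$ and $t(a,b,f):=(a\to b)\leftrightarrow((a\wedge f)\to(b\wedge f))$. A filter is a subset $F\subseteq A$ with $1\in F$, closed under $\wedge$, and upward closed. A filter $F$ is congruent if $t(a,b,f)\in F$ for every $a,b\in A$ and $f\in F$. *)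

(* Defs.v *)
From mathcomp Require Import all_boot all_order.
From mathcomp Require Import boolp classical_sets.

Set Implicit Arguments.
Unset Strict Implicit.
Unset Printing Implicit Defensive.

Import Order.LTheory.
Local Open Scope order_scope.

(* The greatest element 1 of the semilattice is \top, and the library's order
   satisfies a <= b iff a `&` b = a (leEmeet). *)
Section Hemiimplicative.
Context {d : Order.disp_t} {A : tMeetSemilatticeType d}.
Implicit Types (imp : A -> A -> A) (F : set A).

Record hemiimplicative imp : Prop := Hemiimplicative {
  hemiimp_refl : forall a, imp a a = \top;
  hemiimp_le : forall a b c, a <= imp b c -> a `&` b <= c
}.

Definition biimp imp (a b : A) : A := imp a b `&` imp b a.

Definition tterm imp (a b f : A) : A :=
  biimp imp (imp a b) (imp (a `&` f) (b `&` f)).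

Record semilattice_filter F : Prop := SemilatticeFilter {
  slfilter_top : F \top;
  slfilter_meet : forall a b, F a -> F b -> F (a `&` b);
  slfilter_up : forall a b, F a -> a <= b -> F b
}.

Definition congruent imp F : Prop :=
  forall a b f, F f -> F (tterm imp a b f).

End Hemiimplicative.

Section TwoValued.
Context {d : Order.disp_t} {A : tbMeetSemilatticeType d}.

Definition imp_eq (a b : A) : A := if a == b then \top else \bot.

Definition imp_le (a b : A) : A := if a <= b then \top else \bot.

Lemma imp_eq_hemiimplicative : hemiimplicative imp_eq.
Proof.
split=> [a|a b c]; rewrite /imp_eq ?eqxx //.
case: eqP => [-> _|_]; first exact: leIr.
by rewrite lex0 => /eqP ->; rewrite meet0x le0x.
Qed.

Lemma imp_le_hemiimplicative : hemiimplicative imp_le.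
Proof.
split=> [a|a b c]; rewrite /imp_le ?lexx //.
case: ifP => [bc _|_]; first exact: le_trans (leIr _ _) bc.
by rewrite lex0 => /eqP ->; rewrite meet0x le0x.
Qed.

End TwoValued.

(* Main.v *)
(* If [f <> 1] lies in [F], then [1 -> f = 0] while
   [(1 /\ f) -> (f /\ f) = 1], so [t(1, f, f) = 0 <-> 1 = 0] lies in [F]. *)
Require Import Defs.
From mathcomp Require Import all_boot all_order.
From mathcomp Require Import boolp classical_sets.

Import Order.LTheory.
Local Open Scope order_scope.

Section Congruent.
Context {d : Order.disp_t} {A : tbMeetSemilatticeType d}.
Implicit Types (imp : A -> A -> A) (F : set A).

(** Both operations satisfy [1 -> b = 0] for [b <> 1]. Hence a congruent filter with an element
    [f <> 1] contains [t(1, f, f) = 0] ([tterm_top_bot]) and is all of [A]. Conversely, [t(a, b, 1)]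
    has the form [x <-> x = 1], so [{1}] is congruent. *)

Lemma congruent_set1_top imp :
  hemiimplicative imp -> congruent imp [set \top]%classic.
Proof.
move=> Himp a b _ /= ->.
by rewrite /tterm /biimp !meetx1 (hemiimp_refl Himp) meetx1.
Qed.

Lemma tterm_top_bot imp (f : A) : hemiimplicative imp ->
  (forall b, b != \top -> imp \top b = \bot) ->
  f != \top -> tterm imp \top f f = \bot.
Proof.
(* If [0 = 1] then every element is 1, against [f <> 1]; so [imp0] also yields [1 -> 0 = 0]. *)
move=> Himp imp0 f1; have bot1 : (\bot : A) != \top.
  by apply: contraNneq f1 => bot1; rewrite -le1x -bot1 le0x.
by rewrite /tterm /biimp meet1x meetxx (hemiimp_refl Himp) (imp0 f) // imp0 // meetx0.
Qed.

Lemma semilattice_filter_bot F :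
  semilattice_filter F -> F \bot -> F = [set: A]%classic.
Proof.
move=> HF F0; apply/seteqP; split=> // a _.
exact: slfilter_up HF _ _ F0 (le0x a).
Qed.

End Congruent.

Theorem proposition4p5 (d : Order.disp_t) (A : tbMeetSemilatticeType d)
    (imp : A -> A -> A) (Himp : hemiimplicative imp)
    (Hcase : (forall a b : A, imp a b = imp_eq a b) \/
             (forall a b : A, imp a b = imp_le a b))
    (F : set A) (HF : semilattice_filter F) :
  congruent imp F <-> (F = [set \top]%classic \/ F = [set: A]%classic).
Proof.
(* The common feature of the two operations; in the order case, [1 <= b] forces [b = 1]. *)
have imp0 b : b != \top -> imp \top b = \bot.
  case: Hcase => -> /negPf b1; first by rewrite /imp_eq eq_sym b1.
  by rewrite /imp_le le1x b1.
split=> [cF|[->|->]]; [|exact: congruent_set1_top|by []].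
have [[f [Ff /eqP f1]]|noF] := pselect (exists f, F f /\ f <> \top).
  right; apply: semilattice_filter_bot => //.
  by rewrite -(tterm_top_bot _ f Himp imp0 f1); apply: cF.
left; apply/seteqP; split=> [f Ff /=|_ ->]; last exact: slfilter_top HF.
by apply: contrapT => f1; apply: noF; exists f.
Qed.
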